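(* Let $h$ be an M-determinate probability measure on $S^1\times\mathbf{R}$ all of whose absolute moments exist, let $K>0$, let $g$ be the frequency distribution of $h$, let $\{P_m\}_{m\ge0}$ be the orthonormal polynomials of $g$, and let $a_n,b_n$ be the real coefficients of their three-term recurrence $\omega P_n=b_nP_{n+1}+a_nP_n+b_{n-1}P_{n-1}$. Then the following two families of functions satisfy the same system of differential equations $$\frac{dY^m_k}{dt}=\sqrt{-1}\,k\bigl(b_mY^{m+1}_k+a_mY^m_k+b_{m-1}Y^{m-1}_k\bigr)+\frac{kK}{2}\bigl(Y^0_1Y^m_{k-1}-Y^0_{-1}Y^m_{k+1}\bigr),\qquad m=0,1,2,\dots,\ k\in\mathbf{Z}$$ (the moments system): (a) $Y^m_k(t)=Z^m_k(t):=\int_{\mathbf{R}}\int_0^{2\pi}P_m(\omega)e^{\sqrt{-1}k\theta}\,d\rho_t$, where $\rho_t$ is the solution of the continuous Kuramoto model with initial measure $\rho_0=h$; (b) for any $N$, $Y^m_k(t)=\hat Z^m_k(t):=\frac1N\sum_{j=1}^NP_m(\omega_j)e^{\sqrt{-1}k\theta_j(t)}$, where $\theta_1(t),\dots,\theta_N(t)$ is any solution of the $N$-dimensional Kuramoto model $\frac{d\theta_i}{dt}=\omega_i+\frac KN\sum_{j=1}^N\sin(\theta_j-\theta_i)$, $i=1,\dots,N$, with natural frequencies $\omega_1,\dots,\omega_N\in\mathbf{R}$.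
   Context: $S^1=\mathbf{R}/2\pi\mathbf{Z}$. Continuous Kuramoto model with initial probability measure $h$ on $S^1\times\mathbf{R}$: the evolution equation for probability measures $\rho_t=\rho_t(\theta,\omega)$ on $S^1\times\mathbf{R}$ $$\frac{\partial\rho_t}{\partial t}+\frac{\partial}{\partial\theta}\Bigl(\bigl(\omega+\tfrac{K}{2\sqrt{-1}}(Z^0_1(t)e^{-\sqrt{-1}\theta}-\overline{Z^0_1(t)}e^{\sqrt{-1}\theta})\bigr)\rho_t\Bigr)=0,\quad Z^0_1(t)=\int_{\mathbf{R}}\int_0^{2\pi}e^{\sqrt{-1}\theta}d\rho_t,\quad \rho_0=h.$$ Solutions are understood in the weak sense: let $x(t,s;\theta,\omega)\in S^1$ be the solution of $$\frac{d}{dt}x(t,s;\theta,\omega)=\omega+K\int_{\mathbf{R}}\int_0^{2\pi}\sin\bigl(x(t,0;\theta',\omega')-x(t,s;\theta,\omega)\bigr)\,dh(\theta',\omega'),\qquad x(s,s;\theta,\omega)=\theta.$$ The weak solution is $$\rho_t(\theta,\omega)=h(x(0,t;\theta,\omega),\omega)\exp\Bigl[K\int_0^t ds\int_{\mathbf{R}}\int_0^{2\pi}\cos\bigl(x(s,0;\theta',\omega')-x(s,t;\theta,\omega)\bigr)dh(\theta',\omega')\Bigr],$$ i.e. $\rho_t$ is the measure characterized by $\int\int a(\theta,\omega)\,d\rho_t=\int\int a(x(t,0;\theta,\omega),\omega)\,dh$ for measurable $a$ (the push-forward of $h$ under $(\theta,\omega)\mapsto(x(t,0;\theta,\omega),\omega)$).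 Absolute moments of $h$: $M^n_k=\int_{\mathbf{R}}\int_0^{2\pi}|\omega^n e^{\sqrt{-1}k\theta}|\,dh$, $n\ge 0$, $k\in\mathbf{Z}$; they exist if they are finite. Moments: $m^n_k=\int_{\mathbf{R}}\int_0^{2\pi}\omega^n e^{\sqrt{-1}k\theta}\,dh$. The measure $h$ is M-determinate if it is the unique probability measure on $S^1\times\mathbf{R}$ with its moments $\{m^n_k\}_{n,k}$. The frequency distribution $g$ of $h$ is the probability measure on $\mathbf{R}$ given by $g(E)=\int_{\mathbf{R}}\int_0^{2\pi}\chi_E(\omega)\,dh$ for Borel sets $E$ (the $\omega$-marginal of $h$). $\{P_m(\omega)\}_{m=0}^\infty$ is the orthonormal system in $L^2(\mathbf{R},dg)$ of real polynomials, $\deg P_m=m$, $P_0\equiv1$, obtained from $\{\omega^m\}_{m=0}^\infty$ by Gram–Schmidt orthogonalization (so it is assumed that this yields a polynomial $P_m$ for every $m\ge0$, i.e. that the support of $g$ is infinite). These satisfy $\omega P_n=b_nP_{n+1}+a_nP_n+b_{n-1}P_{n-1}$, $n=0,1,2,\dots$, with real constants $a_n,b_n$ determined by $g$. For index $0$, the terms $b_{-1}P_{-1}$ and $b_{-1}Y^{-1}_k$ are taken to be $0$. *)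

(* Defs.v *)
From HB Require Import structures.
From mathcomp Require Import all_boot all_order all_algebra.
From mathcomp Require Import generic_quotient ring_quotient complex.
From mathcomp Require Import all_classical all_reals all_analysis.

Set Implicit Arguments.
Unset Strict Implicit.
Unset Printing Implicit Defensive.

Import Order.TTheory GRing.Theory Num.Theory.
Import numFieldNormedType.Exports.

Local Open Scope classical_set_scope.
Local Open Scope ring_scope.
Local Open Scope complex_scope.
Local Open Scope quotient_scope.

(* The subgroup 2 pi Z of R. *)
Definition period_lattice (R : realType) : {pred R} :=
  [pred x | x / (2 * pi) \is a Num.int].

Lemma period_lattice_zmod_closed (R : realType) :
  zmod_closed (@period_lattice R).
Proof.
by split=> [|x y]; rewrite !inE ?mul0r ?rpred0// mulrBl; exact: rpredB.
Qed.

HB.instance Definition _ (R : realType) :=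
  GRing.isZmodClosed.Build R (@period_lattice R) (@period_lattice_zmod_closed R).

(* S^1 = R / 2 pi Z with the quotient group structure, the quotient topology,
   and the Borel sigma-algebra of that topology. *)
Definition circle (R : realType) : Type :=
  quotient_topology (Quotient.quot (@period_lattice R)).

Section circle_structures.
Variable R : realType.

HB.instance Definition _ := Topological.on (circle R).
HB.instance Definition _ := Pointed.on (circle R).
HB.instance Definition _ := Quotient.on (circle R).
HB.instance Definition _ :=
  GRing.Zmodule.copy (circle R) (Quotient.quot (@period_lattice R)).
HB.instance Definition _ :=
  Measurable.copy (circle R) (g_sigma_algebraType (@open (circle R))).

End circle_structures.

Section circle_functions.
Variable R : realType.
Implicit Types (u x y : R) (th : circle R).

Definition to_circle x : circle R := \pi_(circle R) x.

(* Applying a 2 pi-periodic function to the canonical representative is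
   independent of the representative: see expi_to_circle and
   circle_sin_to_circle. *)
Definition expi th : R[i] := cos (repr th) +i* sin (repr th).

Definition circle_sin th : R := sin (repr th).

Lemma to_circleB x y : to_circle (x - y) = to_circle x - to_circle y.
Proof.
by rewrite /to_circle (Quotient.pi_add _ x (- y)) (Quotient.pi_opp _ y).
Qed.

Lemma repr_to_circle x : exists k : int, repr (to_circle x) = x + k%:~R * (2 * pi).
Proof.
have : repr (to_circle x) - x \in @period_lattice R.
  by rewrite Quotient.idealrBE; apply/eqP; exact: (reprK (to_circle x)).
move=> /intrP[k xk].
exists k; apply/eqP; rewrite addrC -subr_eq -xk divfK//.
by rewrite mulf_neq0// gt_eqF// pi_gt0.
Qed.

Lemma cos_sin_periodic x (k : int) :
  cos (x + k%:~R * (2 * pi)) = cos x /\ sin (x + k%:~R * (2 * pi)) = sin x.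
Proof.
have nat_period y (n : nat) :
    cos (y + n%:R * (2 * pi)) = cos y /\ sin (y + n%:R * (2 * pi)) = sin y.
  elim: n => [|n [IHc IHs]]; first by rewrite mul0r addr0.
  rewrite -natr1 mulrDl mul1r addrA [X in _ + X]mulr_natl.
  by rewrite cosD2pi sinD2pi.
case: (intP k) => [|n|n]; first by rewrite mul0r addr0.
  exact: nat_period.
have [c s] := nat_period (x + (- n.+1%:Z)%:~R * (2 * pi)) n.+1.
by move: c s; rewrite intrN mulNr addrNK => <- <-.
Qed.

Lemma expi_to_circle x : expi (to_circle x) = cos x +i* sin x.
Proof.
rewrite /expi; have [k ->] := repr_to_circle x.
by have [-> ->] := cos_sin_periodic x k.
Qed.

Lemma circle_sin_to_circle x : circle_sin (to_circle x) = sin x.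
Proof.
rewrite /circle_sin; have [k ->] := repr_to_circle x.
by have [_ ->] := cos_sin_periodic x k.
Qed.

End circle_functions.

(* Derivative at t relative to a time interval I: the usual derivative at an
   interior point of I, the one-sided one at an endpoint. *)
Definition has_derivative (R : realType) (I : set R) (f : R -> R) (t l : R) :
    Prop :=
  (s - t)^-1 * (f s - f t) @[s --> within I t^'] --> l.

Definition has_complex_derivative (R : realType) (I : set R) (f : R -> R[i])
    (t : R) (l : R[i]) : Prop :=
  has_derivative I (fun s => complex.Re (f s)) t (complex.Re l) /\
  has_derivative I (fun s => complex.Im (f s)) t (complex.Im l).

(* A curve on the circle is differentiable at t when it has a lift to R that is
   differentiable at t; the lift need not be continuous away from t. *)
Definition has_circle_derivative (R : realType) (I : set R) (x : R -> circle R)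
    (t l : R) : Prop :=
  exists2 phi : R -> R, (forall s, to_circle (phi s) = x s) &
    has_derivative I phi t l.

Definition cintegral d (T : measurableType d) (R : realType)
    (mu : {measure set T -> \bar R}) (f : T -> R[i]) : R[i] :=
  (\int[mu]_z complex.Re (f z)) +i* (\int[mu]_z complex.Im (f z)).

Notation phase_space R := (circle R * R)%type.

Section moments.
Variable R : realType.
Implicit Types h : probability (phase_space R) R.

Definition abs_moment h (n : nat) (k : int) : \bar R :=
  (\int[h]_z (Normc.normc ((z.2 ^+ n)%:C * expi (z.1 *~ k)))%:E)%E.

Definition moments_exist h : Prop :=
  forall n k, (abs_moment h n k < +oo)%E.

Definition moment h (n : nat) (k : int) : R[i] :=
  cintegral h (fun z => (z.2 ^+ n)%:C * expi (z.1 *~ k)).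

Definition M_determinate h : Prop :=
  forall h', moments_exist h' ->
    (forall n k, moment h' n k = moment h n k) ->
    forall A, measurable A -> h' A = h A.

End moments.

HB.instance Definition _ d1 d2 (T1 : measurableType d1) (T2 : measurableType d2) :=
  isMeasurableFun.Build _ _ _ _ (@snd T1 T2) measurable_snd.

Definition freq_distribution (R : realType)
    (h : probability (phase_space R) R) : probability R R :=
  distribution h (@snd (circle R) R).

Definition measure_support (R : realType) (g : set R -> \bar R) : set R :=
  [set w | forall U, open U -> U w -> (0 < g U)%E].

Section orthonormal_polynomials.
Variables (R : realType) (g : {measure set R -> \bar R}).

Definition poly_inner (p q : {poly R}) : R := \int[g]_w (p.[w] * q.[w]).

(* The first n polynomials produced by the Gram-Schmidt process from
   1, X, X^2 and so on. *)
Fixpoint gram_schmidt (n : nat) : seq {poly R} :=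
  if n is m.+1 then
    let s := gram_schmidt m in
    let q := 'X^m - \sum_(p <- s) poly_inner 'X^m p *: p in
    rcons s ((Num.sqrt (poly_inner q q))^-1 *: q)
  else [::].

Definition orthopoly (m : nat) : {poly R} := (gram_schmidt m.+1)`_m.

End orthonormal_polynomials.

(* u_(n-1), with the convention u_(-1) = 0. *)
Definition prev_term (V : zmodType) (u : nat -> V) (n : nat) : V :=
  if n is m.+1 then u m else 0.

Definition three_term_recurrence (R : realType) (P : nat -> {poly R})
    (a b : nat -> R) : Prop :=
  forall n, 'X * P n =
    b n *: P n.+1 + a n *: P n + prev_term (fun j => b j *: P j) n.

Section kuramoto.
Variables (R : realType) (K : R) (I : set R).

(* x t s th w is the position at time t of the characteristic issued from th at
   time s with natural frequency w. Measurability in (th, w) is what gives a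
   meaning to the integral over h and to the push-forward of h. *)
Definition characteristic_flow (h : probability (phase_space R) R)
    (x : R -> R -> circle R -> R -> circle R) : Prop :=
  [/\ forall t, I t ->
        measurable_fun [set: phase_space R]
          (fun z : phase_space R => x t 0 z.1 z.2),
      forall s th w, I s -> x s s th w = th
    & forall s t th w, I s -> I t ->
        has_circle_derivative I (fun t' => x t' s th w) t
          (w + K * \int[h]_z circle_sin (x t 0 z.1 z.2 - x t s th w))].

Definition continuous_kuramoto_solution (h : probability (phase_space R) R)
    (rho : R -> probability (phase_space R) R) : Prop :=
  exists2 x, characteristic_flow h x &
    forall t, I t -> forall A, measurable A ->
      rho t A = pushforward h
        (fun z : phase_space R => (x t 0 z.1 z.2, z.2) : phase_space R) A.

Definition kuramoto_solution (N : nat) (omega : 'I_N -> R)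
    (theta : 'I_N -> R -> circle R) : Prop :=
  forall i t, I t ->
    has_circle_derivative I (theta i) t
      (omega i + K / N%:R * \sum_(j < N) circle_sin (theta j t - theta i t)).

Definition moments_system (a b : nat -> R) (Y : nat -> int -> R -> R[i]) :
    Prop :=
  forall (m : nat) (k : int) (t : R), I t ->
    has_complex_derivative I (Y m k) t
      ('i%C * k%:~R * ((b m)%:C * Y m.+1 k t + (a m)%:C * Y m k t
                     + prev_term (fun j => (b j)%:C * Y j k t) m)
       + k%:~R * K%:C / 2 * (Y 0%N 1 t * Y m (k - 1) t
                             - Y 0%N (- 1) t * Y m (k + 1) t)).

End kuramoto.

Definition moment_Z (R : realType) (P : nat -> {poly R})
    (rho : R -> probability (phase_space R) R) (m : nat) (k : int) (t : R) :
    R[i] :=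
  cintegral (rho t) (fun z => ((P m).[z.2])%:C * expi (z.1 *~ k)).

Definition moment_hatZ (R : realType) (P : nat -> {poly R}) (N : nat)
    (omega : 'I_N -> R) (theta : 'I_N -> R -> circle R) (m : nat) (k : int)
    (t : R) : R[i] :=
  N%:R^-1 * \sum_(j < N) ((P m).[omega j])%:C * expi (theta j t *~ k).

(* Main.v *)
Require Import Defs.
From HB Require Import structures.
From mathcomp Require Import all_boot all_order all_algebra.
From mathcomp Require Import generic_quotient ring_quotient complex.
From mathcomp Require Import all_classical all_reals all_analysis.
From mathcomp Require Import measurable_realfun ring.
Import Order.TTheory GRing.Theory Num.Theory.
Import numFieldNormedType.Exports.
Local Open Scope classical_set_scope.
Local Open Scope ring_scope.

(** Both families are averages, over an ensemble of oscillators, of the modes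
    p(omega) e^{ik theta}: the ensemble is the phase space with the initial
    measure h, transported by the characteristics, in the continuous model,
    and the set of the N oscillators with the uniform average in the finite
    one. In either ensemble an oscillator moves with velocity
    omega + K E[sin(theta' - theta)], and Euler's formula writes this mean
    field in terms of the averages Y^0_1 and Y^0_{-1} of e^{i theta} and
    e^{-i theta} (average_sin). The time derivative of a mode is ik times its
    velocity times the mode. The frequency part of the velocity replaces P_m
    by omega P_m, which the three-term recurrence expands in P_{m+1}, P_m and
    P_{m-1}; the mean-field part shifts k by one, multiplying by Y^0_1 or
    Y^0_{-1}. By linearity of the average, this yields the right-hand side of
    the moments system in both cases at once (average_mode_rate).

    It remains to differentiate under the average. For a finite mean this is
    the derivative of a sum. For the integral against h it is dominated
    convergence (has_derivative_Rintegral): velocities are at most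
    |omega| + |K|, so by the mean value theorem the difference quotients of a
    mode are bounded by |k| |P_m(omega)| (|omega| + |K|), which is integrable
    because all absolute moments of h are finite. *)

(** * Derivatives relative to an interval *)

Section relative_derivative.
Context {R : realType}.
Implicit Types (I : set R) (f g phi F : R -> R).

Lemma has_derivative_cvg I f t l :
  has_derivative I f t l -> f s @[s --> within I t^'] --> f t.
Proof.
move=> fl.
have st : (s - t) @[s --> within I t^'] --> t - t.
  apply: cvgB; last exact: cvg_cst.
  by move=> A /nbhs_dnbhs; exact: cvg_within.
have : f t + (s - t) * ((s - t)^-1 * (f s - f t)) @[s --> within I t^']
    --> f t + (t - t) * l.
  by apply: cvgD; [exact: cvg_cst|exact: cvgM].
rewrite subrr mul0r addr0; apply: cvg_trans; apply: near_eq_cvg.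
rewrite near_withinE; near=> s => _.
rewrite mulVKf ?subrKC// subr_eq0.
by near: s; exact: nbhs_dnbhs_neq.
Unshelve. all: by end_near. Qed.

(** Caratheodory's slope function of F at phi t avoids dividing by increments
    of phi, which may vanish at points other than t. *)
Lemma has_derivative_comp I phi F t l d :
  is_derive (phi t) 1 F d -> has_derivative I phi t l ->
  has_derivative I (F \o phi) t (d * l).
Proof.
move=> /is_derive1_caratheodory[g [Fg cg <-]] phil.
have gphi : g (phi s) @[s --> within I t^'] --> g (phi t).
  exact: cvg_comp (has_derivative_cvg _ _ _ _ phil) cg.
rewrite /has_derivative.
under eq_fun do rewrite /= Fg mulrCA.
exact: cvgM.
Qed.

Lemma has_derivative_interior I f t l :
  nbhs t I -> has_derivative I f t l -> is_derive t 1 f l.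
Proof.
move=> It fl; apply/is_derive1_caratheodory.
exists (fun z => if z == t then l else (z - t)^-1 * (f z - f t)); split.
- move=> z; case: eqP => [->|/eqP zt]; first by rewrite !subrr mulr0.
  by rewrite mulrC mulVKf// subr_eq0.
- apply/continuous_withinNx; rewrite eqxx.
  have fl' : (s - t)^-1 * (f s - f t) @[s --> t^'] --> l.
    move=> A /fl; rewrite /= !near_simpl near_withinE /= => IA.
    have It1 := nbhs_dnbhs It; near=> s; have : I s by near: s.
    by near: s; exact: IA.
  apply: cvg_trans fl'; apply: near_eq_cvg; near=> s.
  rewrite ifN//; near: s; exact: nbhs_dnbhs_neq.
- by rewrite eqxx.
Unshelve. all: by end_near. Qed.

(** Mean value theorem: the derivative relative to the interval is the ordinary
    one inside the segment joining the two points, and gives one-sided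
    continuity at its ends. *)
Lemma has_derivative_lipschitz I f f' B :
  is_interval I -> (forall s, I s -> has_derivative I f s (f' s)) ->
  (forall s, I s -> `|f' s| <= B) ->
  forall s t, I s -> I t -> `|f s - f t| <= B * `|s - t|.
Proof.
move=> itvI ff' f'B s t Is It.
wlog ts : s t Is It / t <= s => [wlg|].
  have [/wlg|/ltW/wlg] := leP t s; first exact.
  by rewrite distrC (distrC s); exact.
have subI x : x \in `[t, s]%R -> I x.
  by rewrite in_itv/= => txs; exact: itvI txs.
have der x : x \in `]t, s[%R -> is_derive x 1 f (f' x).
  move=> xts; apply: (has_derivative_interior I); last first.
    by apply: ff'; apply: subI; exact: subset_itv_oo_cc.
  apply: filterS (near_in_itvoo xts) => y yts; apply: subI.
  exact: subset_itv_oo_cc.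
have cont : {within `[t, s], continuous f}.
  apply/subspace_continuousP => x /subI/ff'/has_derivative_cvg fx A /[dup] fxA.
  move=> /fx; rewrite /= !near_simpl !near_withinE => xA.
  near=> y => yts; have [->|yx] := eqVneq y x; first exact: nbhs_singleton.
  move: yx (subI _ yts); near: y; exact: xA.
have [c cts ->] := MVT_segment ts der cont.
by rewrite normrM ler_wpM2r//; apply: f'B; exact: subI.
Unshelve. all: by end_near. Qed.

Lemma eq_in_has_derivative I f g t l :
  I t -> {in I, f =1 g} -> has_derivative I f t l -> has_derivative I g t l.
Proof.
move=> It fg; apply: cvg_trans; apply: near_eq_cvg; rewrite near_withinE.
by near=> s => Is; rewrite !fg// inE.
Unshelve. all: by end_near. Qed.

Lemma has_derivativeZ I f t l c :
  has_derivative I f t l -> has_derivative I (fun s => c * f s) t (c * l).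
Proof.
rewrite /has_derivative => fl.
under eq_fun do rewrite -mulrBr mulrCA.
by apply: cvgM fl; exact: cvg_cst.
Qed.

Lemma has_derivative_sum (n : nat) I (f : 'I_n -> R -> R) t (l : 'I_n -> R) :
  (forall i, has_derivative I (f i) t (l i)) ->
  has_derivative I (fun s => \sum_i f i s) t (\sum_i l i).
Proof.
rewrite /has_derivative => fl.
under eq_fun do rewrite -sumrB mulr_sumr.
by apply: cvg_big => [|i _]; [exact: add_continuous|exact: fl].
Qed.

End relative_derivative.

(** * Differentiation under the integral sign *)

Section differentiation_under_integral.
Context {R : realType} {d : measure_display} {T : measurableType d}.
Variable mu : {measure set T -> \bar R}.

(** The mean value theorem bounds the difference quotients by the dominating
    function, so dominated convergence applies along every sequence of times
    in the interval. Extending the quotients by their limit outside of the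
    interval turns the limit relative to it into a limit at a point of the
    line, which sequences detect. *)
Lemma has_derivative_Rintegral (I : set R) (f f' : R -> T -> R) (B : T -> R) t :
  is_interval I -> I t ->
  (forall s, I s -> mu.-integrable setT (EFin \o f s)) ->
  (forall z s, I s -> has_derivative I (f^~ z) s (f' s z)) ->
  measurable_fun setT (f' t) ->
  mu.-integrable setT (EFin \o B) ->
  (forall z s, I s -> `|f' s z| <= B z) ->
  has_derivative I (fun s => \int[mu]_z f s z) t (\int[mu]_z f' t z).
Proof.
move=> itvI It intf ff' mf' intB f'B.
pose q s z := if s \in I then (s - t)^-1 * (f s z - f t z) else f' t z.
(* The two branches of q have the same limit at t. *)
have q_cvg z : q s z @[s --> t^'] --> f' t z.
  move=> A /[dup] Af' /(ff' z t It); rewrite /= !near_simpl near_withinE => IA.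
  near=> s; rewrite /q; case: ifPn => [|_]; last exact: nbhs_singleton.
  by rewrite inE; near: s; exact: IA.
have intq s : mu.-integrable setT (EFin \o q s) /\ forall z, `|q s z| <= B z.
  have fB z := le_trans (normr_ge0 _) (f'B z _ It).
  rewrite /q; case: (boolP (s \in I)) => [|_]; last first.
    split; last by move=> z; exact: f'B.
    apply: le_integrable intB => //; first exact/measurable_EFinP.
    by move=> z _; rewrite lee_fin (ger0_norm (fB z)) f'B.
  rewrite inE => Is; split.
    have := integrableZl measurableT (s - t)^-1
      (integrableB measurableT (intf _ Is) (intf _ It)).
    by apply: eq_integrable => // z _ /=; rewrite EFinM EFinB.
  move=> z; have [->|st] := eqVneq s t; first by rewrite subrr invr0 mul0r normr0.
  rewrite normrM normfV ler_pdivrMl ?normr_gt0 ?subr_eq0// mulrC.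
  by apply: (has_derivative_lipschitz _ _ _ _ itvI (ff' z)) => // r; exact: f'B.
have intf' : mu.-integrable setT (EFin \o f' t).
  apply: le_integrable intB => //; first exact/measurable_EFinP.
  move=> z _; rewrite lee_fin (le_trans (f'B z _ It))//; exact: ler_norm.
have cvgq : \int[mu]_z q s z @[s --> t^'] --> \int[mu]_z f' t z.
  apply/cvgr_dnbhsP => u ut.
  have [|||||_ _] := @dominated_convergence _ _ _ mu _ measurableT
    (fun n => EFin \o q (u n)) (EFin \o f' t) (EFin \o B).
  - by move=> n; have [/measurable_int] := intq (u n).
  - exact/measurable_EFinP.
  - apply: aeW => z _; apply: cvg_EFin; first exact: nearW.
    by have /cvgr_dnbhsP := q_cvg z; exact.
  - exact: intB.
  - by apply: aeW => z n _; rewrite lee_fin; have [_] := intq (u n).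
  rewrite -(fineK (integrable_fin_num measurableT intf')) => qf'.
  exact: fine_cvg qf'.
move=> A /cvgq; rewrite /= !near_simpl near_withinE.
apply: filterS => s + Is; rewrite /q mem_set//.
rewrite RintegralZl ?RintegralB//; [exact: intf|exact: intf|].
have := integrableB measurableT (intf _ Is) (intf _ It).
by apply: eq_integrable.
Unshelve. all: by end_near. Qed.

End differentiation_under_integral.

(** * Harmonics on the circle *)

Section complex_parts.
Context {R : realType}.
Implicit Types (r : R) (c z : R[i]).

Lemma ReZ r z : complex.Re (r%:C%C * z) = r * complex.Re z.
Proof. by case: z => u v /=; rewrite mul0r subr0. Qed.

Lemma ImZ r z : complex.Im (r%:C%C * z) = r * complex.Im z.
Proof. by case: z => u v /=; rewrite mul0r addr0. Qed.

Lemma Re_i z : complex.Re ('i%C * z) = - complex.Im z.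
Proof. by rewrite mulrC ReiNIm. Qed.

Lemma Im_i z : complex.Im ('i%C * z) = complex.Re z.
Proof. by rewrite mulrC ImiRe. Qed.

Lemma ReM c z : complex.Re (c * z)
  = complex.Re c * complex.Re z - complex.Im c * complex.Im z.
Proof. by case: c z => [? ?] [? ?]. Qed.

Lemma ImM c z : complex.Im (c * z)
  = complex.Re c * complex.Im z + complex.Im c * complex.Re z.
Proof. by case: c z => [? ?] [? ?]. Qed.

End complex_parts.

HB.instance Definition _ (R : realType) :=
  GRing.isZmodMorphism.Build R (circle R) (@to_circle R) (@to_circleB R).

Section circle_harmonics.
Context {R : realType}.
Implicit Types (th : circle R) (k : int).

Lemma to_circle_repr th : to_circle (repr th) = th.
Proof. exact: reprK. Qed.

Lemma expi_lift (y : R) k :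
  expi (to_circle y *~ k) = (cos (y * k%:~R) +i* sin (y * k%:~R))%C.
Proof. by rewrite -raddfMz expi_to_circle mulrzr. Qed.

Lemma expiD th1 th2 : expi (th1 + th2) = expi th1 * expi th2.
Proof.
rewrite -(to_circle_repr th1) -(to_circle_repr th2) -raddfD !expi_to_circle.
by rewrite cosD sinD; congr (_ +i* _)%C; rewrite addrC.
Qed.

Lemma circle_sin_expi th :
  (circle_sin th)%:C%C = - 'i%C / 2 * (expi th - expi (- th)).
Proof.
rewrite -(to_circle_repr th) -raddfN !expi_to_circle circle_sin_to_circle.
rewrite cosN sinN.
have -> : (cos (repr th) +i* sin (repr th))%C - (cos (repr th) +i* - sin (repr th))%C
    = 2 * ('i%C * (sin (repr th))%:C%C).
  by apply/eqP; rewrite eq_complex /=; apply/andP; split; apply/eqP; ring.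
rewrite (_ : _ * _ = - 'i%C ^+ 2 * (sin (repr th))%:C%C); last by field.
by rewrite sqr_i opprK mul1r.
Qed.

Lemma normr_cos (x : R) : `|cos x| <= 1.
Proof. by rewrite ler_norml cos_geN1 cos_le1. Qed.

Lemma normr_sin (x : R) : `|sin x| <= 1.
Proof. by rewrite ler_norml sin_geN1 sin_le1. Qed.

(** The sigma-algebra of the circle is generated by its open sets, and that of
    the line by the bounded open intervals. *)
Lemma circle_continuous_measurable (f : circle R -> R) :
  continuous f -> measurable_fun setT f.
Proof.
move=> /continuousP cf; apply: (measurability _ (RGenOpens.measurableE R)).
move=> _ [_ [a [b ->] <-]]; rewrite setTI.
apply: sub_sigma_algebra; exact/cf/interval_open.
Qed.

(** Continuity on the quotient is continuity after composition with the
    projection, which turns the harmonic into a cosine. *)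
Lemma measurable_Re_expi k :
  measurable_fun setT (fun th => complex.Re (expi (th *~ k))).
Proof.
apply: circle_continuous_measurable; apply/quotient_continuous => y.
rewrite (_ : _ \o _ = cos \o ( *%R^~ k%:~R)); last first.
  apply/funext => u; transitivity (complex.Re (expi (to_circle u *~ k))) => //.
  by rewrite expi_lift.
apply: continuous_comp; last exact: continuous_cos.
exact: mulrr_continuous.
Qed.

Lemma measurable_Im_expi k :
  measurable_fun setT (fun th => complex.Im (expi (th *~ k))).
Proof.
apply: circle_continuous_measurable; apply/quotient_continuous => y.
rewrite (_ : _ \o _ = sin \o ( *%R^~ k%:~R)); last first.
  apply/funext => u; transitivity (complex.Im (expi (to_circle u *~ k))) => //.
  by rewrite expi_lift.
apply: continuous_comp; last exact: continuous_sin.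
exact: mulrr_continuous.
Qed.

Lemma normr_Re_expi th : `|complex.Re (expi th)| <= 1.
Proof. exact: normr_cos. Qed.

Lemma normr_Im_expi th : `|complex.Im (expi th)| <= 1.
Proof. exact: normr_sin. Qed.

(** The harmonics of a curve on the circle do not depend on the chosen lift, so
    the lift that is differentiable at t can be used at t, and another one at
    other times. *)
Lemma has_complex_derivative_harmonic (I : set R) (x : R -> circle R) (t v c : R) k :
  has_circle_derivative I x t v ->
  has_complex_derivative I (fun s => c%:C%C * expi (x s *~ k)) t
    ((c * (k%:~R * v))%:C%C * ('i%C * expi (x t *~ k))).
Proof.
move=> [phi phix phit].
have kphit := has_derivativeZ _ _ _ _ k%:~R phit.
have expx s : expi (x s *~ k)
    = (cos (k%:~R * phi s) +i* sin (k%:~R * phi s))%C.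
  by rewrite -phix expi_lift mulrC.
split; rewrite ?ReZ ?ImZ ?Re_i ?Im_i expx/=.
- have -> : (fun s => complex.Re (c%:C%C * expi (x s *~ k)))
      = fun s => c * cos (k%:~R * phi s).
    by apply/funext => s; rewrite ReZ expx.
  rewrite [l in has_derivative _ _ _ l](_ : _
    = c * (- sin (k%:~R * phi t) * (k%:~R * v))); last by ring.
  apply: has_derivativeZ.
  exact: has_derivative_comp (is_derive_cos _) kphit.
- have -> : (fun s => complex.Im (c%:C%C * expi (x s *~ k)))
      = fun s => c * sin (k%:~R * phi s).
    by apply/funext => s; rewrite ImZ expx.
  rewrite [l in has_derivative _ _ _ l](_ : _
    = c * (cos (k%:~R * phi t) * (k%:~R * v))); last by ring.
  apply: has_derivativeZ.
  exact: has_derivative_comp (is_derive_sin _) kphit.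
Qed.

End circle_harmonics.

(** * Averages of modes in a mean field *)

(** An abstract expectation E with its class L of integrable observables. *)
Definition linear_average {R : realType} {Omega : Type}
    (L : set (Omega -> R[i])) (E : (Omega -> R[i]) -> R[i]) : Prop :=
  [/\ forall f g, L f -> L g -> L (fun z => f z + g z),
      forall c f, L f -> L (fun z => c * f z),
      forall f g, L f -> L g -> E (fun z => f z + g z) = E f + E g
    & forall c f, L f -> E (fun z => c * f z) = c * E f].

Definition mode {R : realType} {Omega : Type} (x : Omega -> circle R)
    (w : Omega -> R) (q : {poly R}) (k : int) (z : Omega) : R[i] :=
  (q.[w z])%:C%C * expi (x z *~ k).

Lemma Re_mode {R : realType} {Omega : Type} (x : Omega -> circle R) (w : Omega -> R) q k z :
  complex.Re (mode x w q k z) = q.[w z] * complex.Re (expi (x z *~ k)).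
Proof. exact: ReZ. Qed.

Lemma Im_mode {R : realType} {Omega : Type} (x : Omega -> circle R) (w : Omega -> R) q k z :
  complex.Im (mode x w q k z) = q.[w z] * complex.Im (expi (x z *~ k)).
Proof. exact: ImZ. Qed.

Section mean_field.
Context {R : realType} {Omega : Type}.
Variables (L : set (Omega -> R[i])) (E : (Omega -> R[i]) -> R[i]).
Variables (x : Omega -> circle R) (w v : Omega -> R) (K : R).
Hypothesis avgE : linear_average L E.
Hypothesis Lmode : forall q k, L (mode x w q k).

Let M q k := E (mode x w q k).

Lemma average_modeD p q k : M (p + q) k = M p k + M q k.
Proof.
have [_ _ ED _] := avgE; rewrite /M -ED//; congr E; apply/funext => z.
by rewrite /mode hornerD rmorphD mulrDl.
Qed.

Lemma average_modeZ c p k : M (c *: p) k = c%:C%C * M p k.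
Proof.
have [_ _ _ EZ] := avgE; rewrite /M -EZ//; congr E; apply/funext => z.
by rewrite /mode hornerZ rmorphM mulrA.
Qed.

(** By Euler's formula, the sine coupling sees the ensemble only through its
    first harmonics. *)
Lemma average_sin (y : circle R) :
  E (fun z => (circle_sin (x z - y))%:C%C)
  = - 'i%C / 2 * (M 1 1 * expi (- y) - M 1 (- 1) * expi y).
Proof.
have [_ LZ ED EZ] := avgE.
rewrite (_ : (fun _ => _) = fun z => (- 'i%C / 2 * expi (- y)) * mode x w 1 1 z
    + ('i%C / 2 * expi y) * mode x w 1 (- 1) z).
  by rewrite ED ?EZ; [rewrite /M; ring|exact: Lmode..|exact/LZ/Lmode|exact/LZ/Lmode].
apply/funext => z; rewrite circle_sin_expi opprB !expiD /mode hornerC.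
by rewrite mulr1z mulrN1z rmorph1; ring.
Qed.

Hypothesis mean_field : forall z,
  (v z)%:C%C = (w z)%:C%C + K%:C%C * E (fun z' => (circle_sin (x z' - x z))%:C%C).

(** The moments system before any differentiation in time: rate is the
    derivative of the mode along the motion, as given by
    has_complex_derivative_harmonic. *)
Lemma average_mode_rate (P : nat -> {poly R}) (a b : nat -> R) m k :
  three_term_recurrence P a b -> P 0%N = 1 ->
  let rate z := ((P m).[w z] * (k%:~R * v z))%:C%C * ('i%C * expi (x z *~ k)) in
  L rate /\ E rate =
    'i%C * k%:~R * ((b m)%:C%C * M (P m.+1) k + (a m)%:C%C * M (P m) k
                    + prev_term (fun j => (b j)%:C%C * M (P j) k) m)
    + k%:~R * K%:C%C / 2 * (M (P 0%N) 1 * M (P m) (k - 1)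
                            - M (P 0%N) (- 1) * M (P m) (k + 1)).
Proof.
move=> rec P0 rate; have [LD LZ ED EZ] := avgE.
have Mrec : M ('X * P m) k = (b m)%:C%C * M (P m.+1) k + (a m)%:C%C * M (P m) k
                    + prev_term (fun j => (b j)%:C%C * M (P j) k) m.
  rewrite rec !average_modeD !average_modeZ; congr (_ + _).
  case: m {rate} => [|m] /=; last exact: average_modeZ.
  (* For m = 0 the missing term is the average of the mode of the zero
     polynomial. *)
  by rewrite -(scale0r 0) average_modeZ rmorph0 mul0r.
rewrite -Mrec P0.
have -> : rate = fun z => 'i%C * k%:~R * mode x w ('X * P m) k z
    + (k%:~R * K%:C%C / 2 * M 1 1 * mode x w (P m) (k - 1) z
      + - (k%:~R * K%:C%C / 2 * M 1 (- 1)) * mode x w (P m) (k + 1) z).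
  apply/funext => z; rewrite /rate /mode hornerM hornerX.
  transitivity (((P m).[w z])%:C%C * (k%:~R * (v z)%:C%C)
                * ('i%C * expi (x z *~ k))); first by rewrite !rmorphM rmorph_int.
  rewrite [X in _ = _ * (X * _) + _](_ : _ = (w z)%:C%C * ((P m).[w z])%:C%C);
    last exact: rmorphM.
  rewrite mean_field average_sin !mulrzDr mulr1z mulrN1z !expiD.
  have i2 := sqr_i R.
  ring: i2.
have Lcoupling := LD _ _ (LZ (k%:~R * K%:C%C / 2 * M 1 1) _ (Lmode (P m) (k - 1)))
  (LZ (- (k%:~R * K%:C%C / 2 * M 1 (- 1))) _ (Lmode (P m) (k + 1))).
split; first exact: LD (LZ _ _ (Lmode _ _)) Lcoupling.
rewrite ED ?ED ?EZ//; [rewrite /M; ring|exact: LZ..].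
Qed.

End mean_field.

(** * Integrals of complex observables *)

Section complex_integral.
Context {R : realType} {d : measure_display} {T : measurableType d}.
Variable mu : {measure set T -> \bar R}.

Definition cintegrable (f : T -> R[i]) : Prop :=
  mu.-integrable setT (EFin \o (fun z => complex.Re (f z))) /\
  mu.-integrable setT (EFin \o (fun z => complex.Im (f z))).

Lemma integrable_scale (f : T -> R) (c : R) :
  mu.-integrable setT (EFin \o f) ->
  mu.-integrable setT (EFin \o (fun z => c * f z)).
Proof.
by move=> /(integrableZl measurableT c); apply: eq_integrable.
Qed.

Lemma linear_average_cintegral : linear_average cintegrable (cintegral mu).
Proof.
split=> [f g [fr fi] [gr gi]|c f [fr fi]|f g [fr fi] [gr gi]|c f [fr fi]].
- split.
    apply: eq_integrable (integrableD measurableT fr gr) => // z _ /=.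
    by rewrite raddfD EFinD.
  apply: eq_integrable (integrableD measurableT fi gi) => // z _ /=.
  by rewrite raddfD EFinD.
- split.
    apply: eq_integrable (integrableB measurableT (integrable_scale _ (complex.Re c) fr)
      (integrable_scale _ (complex.Im c) fi)) => // z _ /=.
    by rewrite ReM EFinB.
  apply: eq_integrable (integrableD measurableT (integrable_scale _ (complex.Re c) fi)
    (integrable_scale _ (complex.Im c) fr)) => // z _ /=.
  by rewrite ImM EFinD.
- apply/eqP; rewrite eq_complex /=; apply/andP; split; apply/eqP.
    by rewrite -RintegralD//; apply: eq_Rintegral => z _; rewrite raddfD.
  by rewrite -RintegralD//; apply: eq_Rintegral => z _; rewrite raddfD.
- apply/eqP; rewrite eq_complex ReM ImM /=; apply/andP; split; apply/eqP.
    rewrite -!RintegralZl// -RintegralB//; try exact: integrable_scale.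
    by apply: eq_Rintegral => z _; rewrite ReM.
  rewrite -!RintegralZl// -RintegralD//; try exact: integrable_scale.
  by apply: eq_Rintegral => z _; rewrite ImM.
Qed.

Lemma has_complex_derivative_cintegral (I : set R) (f f' : R -> T -> R[i]) (B : T -> R) t :
  is_interval I -> I t -> (forall s, I s -> cintegrable (f s)) ->
  (forall z s, I s -> has_complex_derivative I (f^~ z) s (f' s z)) ->
  cintegrable (f' t) -> mu.-integrable setT (EFin \o B) ->
  (forall z s, I s -> `|complex.Re (f' s z)| <= B z /\ `|complex.Im (f' s z)| <= B z) ->
  has_complex_derivative I (fun s => cintegral mu (f s)) t (cintegral mu (f' t)).
Proof.
move=> itvI It intf ff' [/measurable_int/measurable_EFinP mr
  /measurable_int/measurable_EFinP mi] intB f'B; split.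
- apply: (has_derivative_Rintegral _ _ (fun s z => complex.Re (f s z))
    (fun s z => complex.Re (f' s z)) B) => //.
  + by move=> s /intf[].
  + by move=> z s /(ff' z)[].
  + by move=> z s /(f'B z)[].
- apply: (has_derivative_Rintegral _ _ (fun s z => complex.Im (f s z))
    (fun s z => complex.Im (f' s z)) B) => //.
  + by move=> s /intf[].
  + by move=> z s /(ff' z)[].
  + by move=> z s /(f'B z)[].
Qed.

Lemma measurable_mode (x : T -> circle R) (w : T -> R) q k :
  measurable_fun setT x -> measurable_fun setT w ->
  measurable_fun setT (fun z => complex.Re (mode x w q k z)) /\
  measurable_fun setT (fun z => complex.Im (mode x w q k z)).
Proof.
move=> mx mw.
have mq : measurable_fun setT (fun z => q.[w z]).
  by apply: measurableT_comp mw; exact: measurable_poly.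
split.
- apply: (eq_measurable_fun (fun z => q.[w z] * complex.Re (expi (x z *~ k)))).
    by move=> z _; rewrite Re_mode.
  by apply: measurable_funM => //; exact: measurableT_comp (measurable_Re_expi k) mx.
- apply: (eq_measurable_fun (fun z => q.[w z] * complex.Im (expi (x z *~ k)))).
    by move=> z _; rewrite Im_mode.
  by apply: measurable_funM => //; exact: measurableT_comp (measurable_Im_expi k) mx.
Qed.

Lemma cintegrable_mode (x : T -> circle R) (w : T -> R) q k :
  measurable_fun setT x -> measurable_fun setT w ->
  mu.-integrable setT (EFin \o (fun z => q.[w z])) ->
  cintegrable (mode x w q k).
Proof.
move=> mx mw intq; have [mRe mIm] := measurable_mode x w q k mx mw.
split; apply: le_integrable (intq) => //; try exact/measurable_EFinP.
- move=> z _; suff: `|complex.Re (mode x w q k z)| <= `|q.[w z]| by [].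
  by rewrite Re_mode normrM ler_piMr// normr_Re_expi.
- move=> z _; suff: `|complex.Im (mode x w q k z)| <= `|q.[w z]| by [].
  by rewrite Im_mode normrM ler_piMr// normr_Im_expi.
Qed.

Lemma cintegral_real (f : T -> R) :
  cintegral mu (fun z => (f z)%:C%C) = (\int[mu]_z f z)%:C%C.
Proof. by rewrite /cintegral /= Rintegral_cst// mul0r. Qed.

End complex_integral.

Lemma Rintegral_image {R : realType} {d1 d2 : measure_display}
    {T1 : measurableType d1} {T2 : measurableType d2}
    (mu : {measure set T1 -> \bar R}) (nu : {measure set T2 -> \bar R})
    (phi : T1 -> T2) (f : T2 -> R) :
  measurable_fun setT phi ->
  (forall A, measurable A -> nu A = pushforward mu phi A) ->
  measurable_fun setT f -> mu.-integrable setT (EFin \o (f \o phi)) ->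
  \int[nu]_z f z = \int[mu]_z f (phi z).
Proof.
move=> mphi nuE mf intf; congr fine.
rewrite (eq_measure_integral (pushforward mu phi)); last first.
  by move=> A mA _; exact: nuE.
rewrite integral_pushforward//; exact/measurable_EFinP.
Qed.

(** The absolute moments with k = 0 are those of the frequency distribution. *)
Lemma integrable_frequency_poly {R : realType} (h : probability (phase_space R) R)
    (q : {poly R}) :
  moments_exist h -> h.-integrable setT (EFin \o (fun z => q.[z.2])).
Proof.
move=> hmom.
have intX n : h.-integrable setT (EFin \o (fun z => z.2 ^+ n)).
  apply/integrableP; split.
    by apply/measurable_EFinP; apply: measurable_funX; exact: measurable_snd.
  apply: le_lt_trans (hmom n 0); rewrite le_eqVlt; apply/orP; left; apply/eqP.
  have normX (z : phase_space R) :
      Normc.normc ((z.2 ^+ n)%:C%C * expi (z.1 *~ 0)) = `|z.2 ^+ n|.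
    rewrite Normc.normcM /= cos2Dsin2 sqrtr1 mulr1 expr0n/= addr0.
    exact: sqrtr_sqr.
  by apply: eq_integral => z _; rewrite normX.
have := integrable_sum measurableT (index_enum 'I_(size q))
  (fun i (_ : xpredT i) => integrable_scale _ _ (q`_i) (intX i)).
apply: eq_integrable => // z _ /=.
by rewrite horner_coef sumEFin.
Qed.

Lemma Rintegral_probability_cst {R : realType} {d : measure_display}
  {T : measurableType d} (mu : probability T R) (c : R) : \int[mu]_z c = c.
Proof.
rewrite Rintegral_cst// [fine _](_ : _ = 1) ?mulr1//.
by transitivity (fine (mu [set: T])) => //; rewrite probability_setT.
Qed.

Lemma orthopoly0 {R : realType} (g : probability R R) : orthopoly g 0 = 1.
Proof.
rewrite /orthopoly /= big_nil subr0 expr0 /poly_inner.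
under eq_Rintegral do rewrite hornerC mulr1.
by rewrite Rintegral_probability_cst sqrtr1 invr1 scale1r.
Qed.

(** * The continuous model *)

(** The ensemble is the phase space with the initial measure, an oscillator
    being at time t on the characteristic issued from its initial phase; the
    push-forward formula for the solution says that the moments are averages
    over this ensemble. *)
Lemma continuous_moments_system {R : realType} (h : probability (phase_space R) R)
    (K : R) (P : nat -> {poly R}) (a b : nat -> R) (I : set R)
    (rho : R -> probability (phase_space R) R) :
  moments_exist h -> three_term_recurrence P a b -> P 0%N = 1 ->
  is_interval I -> I 0 -> continuous_kuramoto_solution K I h rho ->
  moments_system K I a b (moment_Z P rho).
Proof.
move=> hmom rec P0 itvI I0 [x [mx _ dx] rhoE] m k t It.
pose X s (z : phase_space R) := x s 0 z.1 z.2.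
pose w (z : phase_space R) := z.2.
pose v s z := w z + K * \int[h]_z' circle_sin (X s z' - X s z).
have intw q : h.-integrable setT (EFin \o (fun z => q.[w z])).
  exact: integrable_frequency_poly.
have Lmode s q j : I s -> cintegrable h (mode (X s) w q j).
  by move=> Is; apply: cintegrable_mode => //; exact: mx.
have intsin s y : I s ->
    h.-integrable setT (EFin \o (fun z => circle_sin (X s z - y))).
  move=> Is.
  have [_ LZ _ _] := linear_average_cintegral h.
  have shift z : expi (- y) * mode (X s) w 1 1 z = expi (X s z - y).
    by rewrite /mode hornerC rmorph1 mul1r mulr1z -expiD addrC.
  have [_] := LZ (expi (- y)) _ (Lmode s 1 1 Is).
  apply: eq_integrable => // z _.
  by rewrite -[LHS]/((complex.Im (expi (- y) * mode (X s) w 1 1 z))%:E) shift.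
have moment_Z_mode n j s : I s ->
    moment_Z P rho n j s = cintegral h (mode (X s) w (P n) j).
  move=> Is; rewrite /moment_Z /cintegral.
  have [intRe intIm] := Lmode s (P n) j Is.
  have [mRe mIm] := measurable_mode (@fst (circle R) R) (@snd (circle R) R)
    (P n) j measurable_fst measurable_snd.
  have mphi : measurable_fun setT (fun z : phase_space R => (X s z, z.2)).
    by apply: measurable_fun_pair => //; exact: mx.
  by rewrite (Rintegral_image h _ _ _ mphi (rhoE s Is) mRe intRe)
    (Rintegral_image h _ _ _ mphi (rhoE s Is) mIm intIm).
have mean_field s z : (v s z)%:C%C = (w z)%:C%C
    + K%:C%C * cintegral h (fun z' => (circle_sin (X s z' - X s z))%:C%C).
  by rewrite cintegral_real -rmorphM -rmorphD.
have v_bound s z : I s -> `|v s z| <= `|w z| + `|K|.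
  move=> Is; rewrite (le_trans (ler_normD _ _))// lerD2l normrM ler_piMr//.
  have ints := intsin s (X s z) Is.
  apply: le_trans (le_normr_Rintegral measurableT ints) _.
  have int1 : h.-integrable setT (EFin \o cst 1).
    exact: finite_measure_integrable_cst.
  have -> : 1 = \int[h]_z' (cst 1 z') :> R.
    by rewrite Rintegral_probability_cst.
  apply: le_Rintegral => //; first exact: integrable_norm.
  by move=> z' _; exact: normr_sin.
pose rate s z := ((P m).[w z] * (k%:~R * v s z))%:C%C
  * ('i%C * expi (X s z *~ k)).
have [Lrate Erate] := average_mode_rate (cintegrable h) (cintegral h) (X t) w
  (v t) K (linear_average_cintegral h) (fun q j => Lmode t q j It)
  (mean_field t) P a b m k rec P0.
have dmode : has_complex_derivative I
    (fun s => cintegral h (mode (X s) w (P m) k)) t (cintegral h (rate t)).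
  (* |P_m(w)| |w| is written as the absolute value of a polynomial in w, which
     makes its integrability an instance of intw. *)
  pose B z := `|k%:~R| * (`|('X * P m).[w z]| + `|K| * `|(P m).[w z]|).
  apply: (has_complex_derivative_cintegral h I (fun s => mode (X s) w (P m) k) rate B) => //.
  - by move=> s Is; exact: Lmode.
  - by move=> z s Is; apply: has_complex_derivative_harmonic; exact: dx.
  - apply: integrable_scale.
    have := integrableD measurableT (integrable_norm (intw ('X * P m)))
      (integrable_scale _ _ `|K| (integrable_norm (intw (P m)))).
    by apply: eq_integrable => // z _; rewrite /= EFinD.
  - move=> z s Is.
    have rateB : `|(P m).[w z] * (k%:~R * v s z)| <= B z.
      rewrite /B hornerM hornerX !normrM mulrCA ler_wpM2l// -mulrDl mulrC.
      by rewrite ler_wpM2r// v_bound.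
    rewrite /rate ReZ ImZ Re_i Im_i; move: (_ * (_ * _)) rateB => r rB.
    rewrite mulrN normrN !normrM.
    by split; apply: le_trans rB; rewrite ler_piMr// ?normr_Re_expi ?normr_Im_expi.
have -> : 'i%C * k%:~R * ((b m)%:C%C * moment_Z P rho m.+1 k t
      + (a m)%:C%C * moment_Z P rho m k t
      + prev_term (fun j => (b j)%:C%C * moment_Z P rho j k t) m)
    + k%:~R * K%:C%C / 2 * (moment_Z P rho 0 1 t * moment_Z P rho m (k - 1) t
      - moment_Z P rho 0 (- 1) t * moment_Z P rho m (k + 1) t)
    = cintegral h (rate t).
  rewrite Erate !moment_Z_mode//; congr (_ * (_ + _) + _).
  by case: (m) => [//|j] /=; rewrite moment_Z_mode.
by split; [apply: eq_in_has_derivative dmode.1|apply: eq_in_has_derivative dmode.2]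
  => // s; rewrite inE => Is; rewrite moment_Z_mode.
Qed.

(** * The finite model *)

Definition finite_mean {R : realType} (N : nat) (f : 'I_N -> R[i]) : R[i] :=
  N%:R^-1 * \sum_(j < N) f j.

Lemma finite_mean_real {R : realType} (N : nat) (f : 'I_N -> R[i]) :
  finite_mean N f = (N%:R^-1)%:C%C * \sum_(j < N) f j.
Proof. by rewrite fmorphV rmorph_nat. Qed.

Lemma linear_average_finite_mean {R : realType} (N : nat) :
  linear_average setT (@finite_mean R N).
Proof.
split=> // [f g _ _|c f _]; rewrite /finite_mean.
  by rewrite big_split mulrDr.
by rewrite -mulr_sumr mulrCA.
Qed.

Lemma has_complex_derivative_finite_mean {R : realType} (N : nat) (I : set R)
    (f : 'I_N -> R -> R[i]) t (l : 'I_N -> R[i]) :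
  (forall j, has_complex_derivative I (f j) t (l j)) ->
  has_complex_derivative I (fun s => finite_mean N (f^~ s)) t (finite_mean N l).
Proof.
move=> fl; split; rewrite finite_mean_real ?ReZ ?ImZ raddf_sum.
- have -> : (fun s => complex.Re (finite_mean N (f^~ s)))
      = fun s => N%:R^-1 * \sum_j complex.Re (f j s).
    by apply/funext => s; rewrite finite_mean_real ReZ raddf_sum.
  by apply/has_derivativeZ/has_derivative_sum => j; have [] := fl j.
- have -> : (fun s => complex.Im (finite_mean N (f^~ s)))
      = fun s => N%:R^-1 * \sum_j complex.Im (f j s).
    by apply/funext => s; rewrite finite_mean_real ImZ raddf_sum.
  by apply/has_derivativeZ/has_derivative_sum => j; have [] := fl j.
Qed.

(** The ensemble is the finite set of oscillators with the uniform average. *)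
Lemma finite_moments_system {R : realType} (K : R) (P : nat -> {poly R})
    (a b : nat -> R) (N : nat) (I : set R) (omega : 'I_N -> R)
    (theta : 'I_N -> R -> circle R) :
  three_term_recurrence P a b -> P 0%N = 1 -> kuramoto_solution K I omega theta ->
  moments_system K I a b (moment_hatZ P omega theta).
Proof.
move=> rec P0 dtheta m k t It.
pose v j := omega j + K / N%:R * \sum_(i < N) circle_sin (theta i t - theta j t).
have mean_field j : (v j)%:C%C = (omega j)%:C%C
    + K%:C%C * finite_mean N (fun i => (circle_sin (theta i t - theta j t))%:C%C).
  by rewrite finite_mean_real -rmorph_sum -!rmorphM -rmorphD mulrA.
have [_ rateE] := average_mode_rate setT (finite_mean N) (theta^~ t) omega v K
  (linear_average_finite_mean N) (fun _ _ => Logic.I) mean_field P a b m k rec P0.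
have := has_complex_derivative_finite_mean N I
  (fun j s => mode (theta^~ s) omega (P m) k j) t _
  (fun j => has_complex_derivative_harmonic I (theta j) t (v j) ((P m).[omega j]) k
     (dtheta j t It)).
by rewrite rateE.
Qed.

(** * The moments system *)

Theorem mainTheorem2 (R : realType) (h : probability (phase_space R) R) (K : R)
  (a b : nat -> R) :
  moments_exist h -> M_determinate h -> 0 < K ->
  infinite_set (measure_support (freq_distribution h)) ->
  three_term_recurrence (orthopoly (freq_distribution h)) a b ->
  (forall (I : set R) (rho : R -> probability (phase_space R) R),
     is_interval I -> I 0 -> continuous_kuramoto_solution K I h rho ->
     moments_system K I a b (moment_Z (orthopoly (freq_distribution h)) rho)) /\
  (forall (N : nat) (I : set R) (omega : 'I_N -> R)
          (theta : 'I_N -> R -> circle R),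
     (0 < N)%N -> is_interval I -> kuramoto_solution K I omega theta ->
     moments_system K I a b
       (moment_hatZ (orthopoly (freq_distribution h)) omega theta)).
Proof.
move=> hmom _ _ _ rec; have P0 := orthopoly0 (freq_distribution h).
split=> [I rho itvI I0 sol|N I omega theta _ _ sol].
  exact: continuous_moments_system rec P0 itvI I0 sol.
exact: finite_moments_system rec P0 sol.
Qed.
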